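(* Let $\mathbb{F}$ be a field of characteristic $3$, let $E$ be a $12$-dimensional symplectic vector space over $\mathbb{F}$, let $f:\wedge^{6}E\rightarrow\wedge^{4}E$ be the contraction map, and let $B$ be the $\binom{12}{4}\times\binom{12}{6}$ matrix over $\mathbb{F}$ of the system of Plücker linear relations (both defined in the context). Then: (1) $\operatorname{rank}(B)=494$; (2) $\dim_{\mathbb{F}}(\ker f)=\binom{12}{6}-494=430$; (3) the map $f$ is not surjective.
   Context: A symplectic vector space is a finite-dimensional vector space $E$ over a field $\mathbb{F}$ with a non-degenerate alternating bilinear form $\langle\,,\,\rangle$ (alternating: $\langle x,x\rangle=0$ for all $x$). Here $\dim E=12$. The contraction map $f:\wedge^{6}E\to\wedge^{4}E$ is the $\mathbb{F}$-linear map determined by $$f(w_1\wedge\cdots\wedge w_6)=\sum_{1\le s<t\le 6}(-1)^{s+t-1}\langle w_s,w_t\rangle\, w_1\wedge\cdots\wedge\widehat{w}_s\wedge\cdots\wedge\widehat{w}_t\wedge\cdots\wedge w_6,$$ where a hat means that the factor is omitted. For positive integers $\ell\le m$, $I(\ell,m)$ denotes the set of $\ell$-tuples $\alpha=(\alpha_1,\dots,\alpha_\ell)$ of integers with $1\le\alpha_1<\cdots<\alpha_\ell\le m$, identified with the $\ell$-element subsets of $\{1,\dots,m\}$. For $\alpha\in I(4,12)$ the Plücker linear relation attached to $\alpha$ is the homogeneous linear equation $$\Pi_\alpha:\quad \sum_{i=1}^{6}c_{i,\alpha}\,X_{\alpha\cup\{i,13-i\}}=0$$ in the variables $X_\beta$,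 $\beta\in I(6,12)$, where $c_{i,\alpha}=1$ if $|\alpha\cup\{i,13-i\}|=6$ and $c_{i,\alpha}=0$ (the term does not appear) otherwise; variables are indexed by subsets, irrespective of the order of the indices. $B$ is the coefficient matrix over $\mathbb{F}$ of the system $\{\Pi_\alpha:\alpha\in I(4,12)\}$: rows are indexed by $I(4,12)$, columns by $I(6,12)$, and the $(\alpha,\beta)$ entry is $1$ if $\beta=\alpha\cup\{i,13-i\}$ for some $i\in\{1,\dots,6\}$ and $0$ otherwise. *)

(* Defs.v *)
From HB Require Import structures.
From mathcomp Require Import all_boot all_order all_algebra.

Set Implicit Arguments.
Unset Strict Implicit.
Unset Printing Implicit Defensive.

Import GRing.Theory.
Local Open Scope ring_scope.

(* Not [is_psymplectic] of sesquilinear.v: that predicate is about a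
   skew-symmetric form, with alternation added in characteristic 2 only. *)
Definition symplectic (F : fieldType) (E : vectType F) (form : {biscalar E}) :=
  (forall x, form x x = 0) /\
  (forall x, (forall y, form x y = 0) -> x = 0).

Section ExteriorPower.
Variables (F : fieldType) (E : vectType F).

Definition ffun_upd k (x : {ffun 'I_k -> E}) (i : 'I_k) (u : E) :
    {ffun 'I_k -> E} :=
  [ffun j => if j == i then u else x j].

Definition multilinear k (V : vectType F) (g : {ffun 'I_k -> E} -> V) :=
  forall (x : {ffun 'I_k -> E}) (i : 'I_k) (a : F) (u v : E),
    g (ffun_upd x i (a *: u + v)) =
    a *: g (ffun_upd x i u) + g (ffun_upd x i v).

Definition alternating k (V : vectType F) (g : {ffun 'I_k -> E} -> V) :=
  forall (x : {ffun 'I_k -> E}) (i j : 'I_k), i != j -> x i = x j -> g x = 0.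

(* A k-th exterior power of E: a space with an alternating multilinear map
   [wedge x = x 0 /\ ... /\ x k.-1], characterised by its universal property.
   As E is finite-dimensional, so are its exterior powers, and it is enough to
   test the universal property against finite-dimensional spaces. *)
Record extPower k := ExtPower {
  ext_sort :> vectType F;
  wedge : {ffun 'I_k -> E} -> ext_sort;
  wedge_multilinear : multilinear wedge;
  wedge_alternating : alternating wedge;
  wedge_universal : forall (V : vectType F) (g : {ffun 'I_k -> E} -> V),
    multilinear g -> alternating g ->
    exists! h : 'Hom(ext_sort, V), forall x, h (wedge x) = g x
}.

(* The family x with its entries s and t left out, for s < t: [lift t] skips t,
   and, below t, [lift (inord s)] skips s. *)
Definition omit2 k (s t : 'I_k.+2) (x : {ffun 'I_k.+2 -> E}) :
    {ffun 'I_k -> E} :=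
  [ffun j => x (lift t (lift (inord s : 'I_k.+1) j))].

(* Indices start at 0 here, so that the sign (-1) ^ (s + t - 1) of the 1-based
   formula becomes (-1) ^ (s + t + 1). *)
Definition is_contraction (form : {biscalar E}) k
    (W : extPower k.+2) (W' : extPower k) (f : 'Hom(W, W')) :=
  forall x : {ffun 'I_k.+2 -> E},
    f (wedge W x) =
    \sum_(s < k.+2) \sum_(t < k.+2 | (s < t)%N)
      ((-1) ^+ (s + t).+1 * form (x s) (x t)) *: wedge W' (omit2 s t x).

End ExteriorPower.

(* The l-element subsets of {0, ..., m - 1}, each entry being shifted down by
   one. *)
Definition subsets (l m : nat) : {set {set 'I_m}} := [set A : {set 'I_m} | #|A| == l].

(* With 0-based entries, the pair {i, 13 - i} is [set i; rev_ord i], and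
   1 <= i <= 6 reads i < 6. *)
Definition plucker_mx (F : fieldType) : 'M[F]_(#|subsets 4 12|%N, #|subsets 6 12|%N) :=
  \matrix_(a, b)
    [exists i : 'I_12, (i < 6)%N &&
       (enum_val b == enum_val a :|: [set i; rev_ord i])]%:R.

(* Main.v *)
Require Import Defs.
From HB Require Import structures.
From mathcomp Require Import all_boot all_order all_algebra.
From mathcomp Require Import perm ring zify.

Set Implicit Arguments.
Unset Strict Implicit.
Unset Printing Implicit Defensive.

Import GRing.Theory.
Local Open Scope ring_scope.

(* A left null vector of the Pluecker matrix is a function u on 4-sets with
   sum_i u(B \ P_i) = 0 for each 6-set B, over the pairs P_i contained in B.
   Write a 4-set as S + P_J, where S contains no pair and P_J is the union of
   the pairs it contains. If J is empty, u vanishes (add a pair avoiding S).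
   If |J| = 1, at least three pairs avoid S and the values at any two of them
   are opposite, so u vanishes. If |J| = 2, the relations over the triples of
   pairs make u constant, and in characteristic 3 the constant is indeed a
   solution. So the left kernel is a line, and the rank is 495 - 1.
   The contraction is then computed in a symplectic basis in which the vectors
   of a hyperbolic pair are consecutive: every sign (-1)^(s+t-1) that matters
   has t = s + 1, so its matrix is the transpose of the Pluecker matrix of
   these pairs. *)

(** * Left kernel of a pairing matrix *)

Section Pairing.
Variables (T I : finType) (p : I -> {set T}).
Hypothesis card_p : forall i, #|p i| = 2%N.
Hypothesis disj_p : forall i j, i != j -> [disjoint p i & p j].

Definition full (A : {set T}) := [set i | p i \subset A].
Definition avoiding (A : {set T}) := [set i | [disjoint p i & A]].
Definition pairs (J : {set I}) := \bigcup_(i in J) p i.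

Lemma in_pairs J i x : x \in p i -> (x \in pairs J) = (i \in J).
Proof.
move=> xi; apply/bigcupP/idP => [[j jJ xj]|iJ]; last by exists i.
have [->//|neq_ij] := eqVneq i j.
by have /pred0P/(_ x) := disj_p neq_ij; rewrite /= xi xj.
Qed.

Lemma sub_pairs J i : (p i \subset pairs J) = (i \in J).
Proof.
apply/subsetP/idP => [sub|iJ x xi]; last by rewrite (in_pairs _ xi).
have /card_gt0P[x xi] : (0 < #|p i|)%N by rewrite card_p.
by rewrite -(in_pairs _ xi) sub.
Qed.

Lemma card_pairs J : #|pairs J| = (2 * #|J|)%N.
Proof.
rewrite -sum1_card [pairs J]big_mkcond /=.
rewrite (@partition_disjoint_bigcup _ _ _ _ _
  (fun i => if i \in J then p i else set0)) => [|i j neq_ij].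
  rewrite -[#|J|]sum1_card big_distrr /= [RHS]big_mkcond; apply: eq_bigr => i _.
  by rewrite sum1_card; case: ifP; rewrite ?card_p ?cards0.
by case: ifP; case: ifP;
  rewrite ?disjoints0 -?setI_eq0 ?set0I ?setI0 ?setI_eq0 ?disj_p.
Qed.

(** Double counting: the sets [p i] are disjoint, so each element of [A] lies in at most one of
    them. *)
Lemma sum_card_pairsI A : (\sum_i #|A :&: p i| <= #|A|)%N.
Proof.
rewrite -[X in (_ <= X)%N]sum1_card.
have cardI i : #|A :&: p i| = (\sum_(x in A) (x \in p i))%N.
  rewrite -sum1_card [LHS]big_mkcond [RHS]big_mkcond; apply: eq_bigr => x _.
  by rewrite inE; case: (x \in A); case: (x \in p i).
under eq_bigr do rewrite cardI.
rewrite exchange_big /=; apply: leq_sum => x _.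
rewrite -(big_mkcond (fun i => x \in p i) (fun=> 1%N)) sum1_card.
apply/card_le1_eqP => i j xi xj.
have {}xi : x \in p i := xi; have {}xj : x \in p j := xj.
have [//|neq_ij] := eqVneq j i.
by have /pred0P/(_ x) := disj_p neq_ij; rewrite /= xi xj.
Qed.

(** The index [i] contributes [#|A :&: p i|] to the preceding sum: 2 if [p i] is contained in [A],
    which counts in both terms on the left, and at least 1 if [p i] meets [A]. This yields many
    pairs avoiding a small set. *)
Lemma card_full_avoiding A : (#|full A| + #|~: avoiding A| <= #|A|)%N.
Proof.
apply: leq_trans (sum_card_pairsI A).
rewrite -!sum1_card big_mkcond [X in (_ + X)%N]big_mkcond -big_split /=.
apply: leq_sum => i _; rewrite !inE -setI_eq0 setIC -card_gt0.
have [/setIidPr-> | _] := boolP (p i \subset A); first by rewrite card_p.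
by case: posnP.
Qed.

Lemma full_pairs A J : full A = set0 -> full (A :|: pairs J) = J.
Proof.
move=> /setP fA; apply/setP => i; rewrite inE.
apply/idP/idP => [sub | iJ]; last by rewrite subsetU // sub_pairs iJ orbT.
apply: contraTT sub => iJ; apply/negP => sub.
have := fA i; rewrite !inE => /negP[].
apply/subsetP => x xi; have := subsetP sub x xi.
by rewrite inE (in_pairs _ xi) (negPf iJ) orbF.
Qed.

(** With [coreK] and [full_avoiding_core], this gives the decomposition S + P_J of a set, where J is
    [full A] and S is what remains of [A]. *)
Lemma full_core A : full (A :\: pairs (full A)) = set0.
Proof.
apply/setP => i; rewrite !inE; apply/negP => sub.
have /card_gt0P[x xi] : (0 < #|p i|)%N by rewrite card_p.
have := subsetP sub x xi; rewrite inE (in_pairs _ xi) inE => /andP[/negP[]].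
by apply: subset_trans sub (subsetDl _ _).
Qed.

Lemma pairs_full_sub A : pairs (full A) \subset A.
Proof. by apply/bigcupsP => i; rewrite inE. Qed.

Lemma card_full A : (2 * #|full A| <= #|A|)%N.
Proof. by rewrite -card_pairs subset_leq_card ?pairs_full_sub. Qed.

Lemma coreK A : A :\: pairs (full A) :|: pairs (full A) = A.
Proof. by rewrite setUC -{1}(setIidPr (pairs_full_sub A)) setID. Qed.

Lemma avoiding_notin (A : {set T}) (J : {set I}) x : J \subset avoiding A ->
  x \in pairs J -> x \notin A.
Proof.
move=> /subsetP JA /bigcupP[i /JA]; rewrite inE => /pred0P/(_ x) /= + xi.
by rewrite xi /= => ->.
Qed.

Lemma card_setU_pairs (A : {set T}) (J : {set I}) : J \subset avoiding A ->
  #|A :|: pairs J| = (#|A| + 2 * #|J|)%N.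
Proof.
move=> JA; rewrite -card_pairs cardsU (_ : A :&: _ = set0) ?cards0 ?subn0 //.
apply/setP => x; rewrite !inE; apply/andP => -[xA].
by move/(avoiding_notin JA); rewrite xA.
Qed.

Lemma setU_pairsD1 (A : {set T}) (J : {set I}) i : J \subset avoiding A ->
  i \in J ->
  (A :|: pairs J) :\: p i = A :|: pairs (J :\ i).
Proof.
move=> JA iJ; apply/setP => x; rewrite !inE.
have [xi|xi] /= := boolP (x \in p i).
  by rewrite (in_pairs _ xi) !inE eqxx orbF (negPf (avoiding_notin JA _))
    // (in_pairs _ xi).
congr (_ || _); apply/bigcupP/bigcupP => -[j jJ xj]; exists j => //.
  by rewrite !inE jJ andbT; apply: contraNneq xi => <-.
by move: jJ; rewrite !inE => /andP[].
Qed.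

Lemma full_avoiding_core A : full A \subset avoiding (A :\: pairs (full A)).
Proof.
apply/subsetP => i iA; rewrite inE; apply/pred0P => x /=; apply/andP => -[xi].
by rewrite inE (in_pairs _ xi) iA.
Qed.

(** The cardinality of [B] forces [p i] to be disjoint from [A], so adding the pair and removing it
    are inverse operations. *)
Lemma eq_setU_pair (A B : {set T}) i : #|B| = #|A|.+2 ->
  (B == A :|: p i) = (p i \subset B) && (A == B :\: p i).
Proof.
move=> cB; apply/eqP/andP => [defB | [piB /eqP->]].
  have pA : [disjoint p i & A].
    rewrite -setI_eq0 -cards_eq0 setIC.
    by have := cardsUI A (p i); rewrite -defB cB card_p; lia.
  split; first by rewrite defB subsetUr.
  by rewrite defB setDUl setDv setU0 eq_sym; apply/eqP/setDidPl;
    rewrite disjoint_sym.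
by rewrite setUC -{1}(setIidPr piB) setID.
Qed.

(** * Left null vectors in characteristic 3 *)

Section Kernel.
Variables (F : fieldType) (u : {set T} -> F).
Hypothesis char3 : 3%N \in [pchar F].
Hypothesis card_I : #|I| = 6%N.
Hypothesis u_ker :
  forall B : {set T}, #|B| = 6%N -> \sum_(i in full B) u (B :\: p i) = 0.

Lemma double_eq0_char3 (x : F) : x + x = 0 -> x = 0.
Proof.
move=> x2; have := pcharf0 char3 => n3.
have : x * 3%:R = 0 by rewrite n3 mulr0.
by rewrite -[3%N]/(1 + 2)%N natrD mulrDr mulr1 mulr_natr mulr2n x2 addr0.
Qed.

(** This is the relation of the 6-set A + P_J: since [A] contains no pair, the pairs in the 6-set
    are exactly those of [J]. *)
Lemma core_relation (A : {set T}) (J : {set I}) : full A = set0 ->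
  J \subset avoiding A ->
  (#|A| + 2 * #|J| = 6%N)%N -> \sum_(i in J) u (A :|: pairs (J :\ i)) = 0.
Proof.
move=> fA JA cAJ; rewrite -[RHS](u_ker (B := A :|: pairs J))
  ?card_setU_pairs //.
by rewrite full_pairs //; apply: eq_bigr => i iJ; rewrite setU_pairsD1.
Qed.

Lemma ker_eq0_full0 (A : {set T}) : #|A| = 4%N -> full A = set0 -> u A = 0.
Proof.
move=> cA fA.
have [j jA] : exists j, j \in avoiding A.
  (* Four elements meet at most four of the six pairs. *)
  apply/card_gt0P; have := card_full_avoiding A; have := cardsC (avoiding A).
  by rewrite card_I cA; lia.
have := core_relation (J := [set j]) fA.
by rewrite sub1set cards1 cA big_set1 setDv /pairs big_set0 setU0; apply.
Qed.

Lemma ker_eq0_full1 (A : {set T}) i : #|A| = 4%N -> full A = [set i] -> u A = 0.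
Proof.
move=> cA fA; pose C := A :\: p i.
have pA : pairs (full A) = p i by rewrite fA /pairs big_set1.
have fC : full C = set0 by rewrite /C -pA full_core.
have iC : i \in avoiding C.
  by have := full_avoiding_core A; rewrite pA fA sub1set.
have defA : A = C :|: p i by rewrite /C -pA coreK.
have cC : #|C| = 2%N.
  have := card_setU_pairs (A := C) (J := [set i]).
  by rewrite sub1set iC cards1 /pairs big_set1 -defA cA => /(_ isT); lia.
have [j [k [jC kC neq]]] :
  exists j k, [/\ j \in avoiding C, k \in avoiding C
    & [&& i != j, i != k & j != k]].
  (* The two elements of [C] meet at most two of the six pairs, so at least four pairs avoid [C],
     and [i] is one of them. *)
  have : (1 < #|avoiding C :\ i|)%N.
    have := card_full_avoiding C; have := cardsC (avoiding C).
    by rewrite card_I cC (cardsD1 i) iC; lia.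
  case/card_gt1P => j [k []]; rewrite !inE => /andP[ij jC] /andP[ik kC] jk.
  by exists j, k; rewrite !inE; split => //; rewrite eq_sym ij eq_sym ik.
have rel a b : a \in avoiding C -> b \in avoiding C -> a != b ->
  u (C :|: p b) + u (C :|: p a) = 0.
  move=> aC bC ab; have := core_relation (J := [set a; b]) fC.
  rewrite subUset !sub1set aC bC cC cards2 ab => /(_ isT erefl).
rewrite big_setU1 ?inE //= big_set1 setU1K ?inE //
  [[set a; b]]setUC setU1K ?inE 1?eq_sym //.
  by rewrite /pairs !big_set1.
have /and3P[ij ik jk] := neq.
have := rel _ _ iC jC ij; have := rel _ _ iC kC ik; have := rel _ _ jC kC jk.
rewrite -defA; set z := u _; set y := u _; set x := u _ => e1 e2 e3.
apply: double_eq0_char3.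
(* Three values with pairwise sums zero: twice each of them vanishes. *)
by rewrite (_ : x + x = (y + x) + (z + x) - (z + y)); [|ring];
  rewrite e1 e2 e3; ring.
Qed.

(** The case of an empty core, where the 6-set is a union of three pairs. *)
Lemma pair_relation i j k : i != j -> i != k -> j != k ->
  u (pairs [set j; k]) + u (pairs [set i; k]) + u (pairs [set i; j]) = 0.
Proof.
move=> ij ik jk; have f0 : full set0 = set0.
  by apply/setP => l; rewrite !inE subset0 -cards_eq0 card_p.
have set3D1 a b c : a != b -> a != c -> [set a; b; c] :\ a = [set b; c].
  by move=> ab ac; rewrite -setUA setU1K // !inE negb_or ab.
have ji : j != i by rewrite eq_sym.
have ki : k != i by rewrite eq_sym.
have kj : k != j by rewrite eq_sym.
have D1 : [set i; j; k] :\ i = [set j; k] by rewrite set3D1.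
have D2 : [set i; j; k] :\ j = [set i; k] by rewrite [[set i; j]]setUC set3D1.
have D3 : [set i; j; k] :\ k = [set i; j] by rewrite setUC setUA set3D1.
have := core_relation (J := [set i; j; k]) f0.
have cJ : #|[set i; j; k]| = 3%N.
  by rewrite -setUA cardsU1 cards2 !inE negb_or ij ik jk.
rewrite cards0 cJ -{2}setUA big_setU1 ?inE ?negb_or ?ij //= big_setU1 ?inE //=
  big_set1.
rewrite D1 D2 D3 !set0U addrA; apply=> //; apply/subsetP => l _.
by rewrite inE; apply/pred0P => x; rewrite /= inE andbF.
Qed.

(** View [u] as a weight on the edges of the complete graph on i, j, k, l; each triangle has weight
    0. Adding the two triangles through ij and subtracting the two through kl cancels the four mixed
    edges and leaves twice the difference sought. *)
Lemma ker_pairs2_disjoint (J K : {set I}) : #|J| = 2%N -> #|K| = 2%N ->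
  [disjoint J & K] ->
  u (pairs J) = u (pairs K).
Proof.
move=> /eqP/cards2P[i [j [ij ->]]] /eqP/cards2P[k [l [kl ->]]].
move=> dis; have := disjointFr dis (set21 i j);
  have := disjointFr dis (set22 i j).
rewrite !inE => /norP[jk jl] /norP[ik il].
have := pair_relation ij ik jk; have := pair_relation ij il jl.
have := pair_relation ik il kl; have := pair_relation jk jl kl.
set x := u (pairs [set i; j]); set y := u (pairs [set k; l]).
set a := u _; set b := u _; set c := u _; set d := u _ => e1 e2 e3 e4.
apply/eqP; rewrite -subr_eq0; apply/eqP/double_eq0_char3.
transitivity ((a + c + x) + (b + d + x) - (y + a + b) - (y + c + d));
  first by ring.
by rewrite e1 e2 e3 e4; ring.
Qed.

(** [J] and [K] cover at most four of the six indices; two remaining ones form a set disjoint from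
    both, to which each is compared. *)
Lemma ker_pairs2 (J K : {set I}) : #|J| = 2%N -> #|K| = 2%N ->
  u (pairs J) = u (pairs K).
Proof.
move=> cJ cK.
have : (1 < #|~: (J :|: K)|)%N.
  by have := cardsC (J :|: K); rewrite card_I; have := cardsUI J K;
    rewrite cJ cK; lia.
case/card_gt1P => k [l []]; rewrite !inE => /norP[kJ kK] /norP[lJ lK] kl.
have ckl : #|[set k; l]| = 2%N by rewrite cards2 kl.
have dis (A : {set I}) : k \notin A -> l \notin A -> [disjoint A & [set k; l]].
  move=> kA lA; apply/pred0P => i /=; rewrite !inE.
  by apply/andP => -[iA /orP[]/eqP eqi];
    rewrite eqi ?(negPf kA) ?(negPf lA) in iA.
by rewrite (ker_pairs2_disjoint cJ ckl) ?(ker_pairs2_disjoint cK ckl) ?dis.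
Qed.

Lemma card4_full2 (A : {set T}) : #|A| = 4%N -> #|full A| = 2%N ->
  A = pairs (full A).
Proof.
move=> cA fA; apply/esym/eqP.
by rewrite eqEcard pairs_full_sub card_pairs fA cA.
Qed.

Lemma ker_indicator : exists c, forall A : {set T}, #|A| = 4%N ->
  u A = c * (#|full A| == 2%N)%:R.
Proof.
have [J cJ] : exists J : {set I}, #|J| = 2%N.
  have /card_gt1P[i [j [_ _ ij]]] : (1 < #|I|)%N by rewrite card_I.
  by exists [set i; j]; rewrite cards2 ij.
exists (u (pairs J)) => A cA.
have := card_full A; rewrite cA.
have [f2 _ | nf2] := eqVneq #|full A| 2%N.
  by rewrite mulr1 [in LHS](card4_full2 cA f2); apply: ker_pairs2.
rewrite mulr0; case f0 : #|full A| nf2 => [|[|[|n]]] // _ cfull; last by lia.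
  by apply: ker_eq0_full0 => //; apply/eqP; rewrite -cards_eq0 f0.
by have /eqP/cards1P[i fi] := f0; apply: ker_eq0_full1 fi.
Qed.
End Kernel.

(** A 6-set contains r <= 3 pairs, and removing one leaves r - 1. Hence the terms vanish unless r =
    3, and then the sum is 3 = 0 in [F]. *)
Lemma indicator_ker (F : fieldType) (char3 : 3%N \in [pchar F]) (B : {set T}) :
  #|B| = 6%N ->
  \sum_(i in full B) (#|full (B :\: p i)| == 2%N)%:R = 0 :> F.
Proof.
move=> cB.
have fullD i : i \in full B -> #|full (B :\: p i)| = #|full B|.-1.
  move=> iB; rewrite (cardsD1 i (full B)) iB; congr #|pred_of_set _|.
  apply/setP => j; rewrite !inE subsetD.
  have [->|ji] := eqVneq j i; last by rewrite disj_p ?andbT.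
  rewrite andbC -setI_eq0 setIid -cards_eq0 card_p.
  by [].
under eq_bigr do rewrite fullD //.
rewrite sumr_const; have := card_full B; rewrite cB => le6.
have [->|n3] := eqVneq #|full B| 3%N.
  by rewrite -[LHS]mulr_natr (pcharf0 char3) mulr0.
case: #|full B| n3 le6 => [|[|[|[|n]]]] //= _ le6; rewrite ?mul0rn //; lia.
Qed.

End Pairing.

(** * The rank of a pairing matrix *)

Section PairingMatrix.
Variables (F : fieldType) (p : 'I_6 -> {set 'I_12}).
Hypothesis char3 : 3%N \in [pchar F].
Hypothesis card_p : forall i, #|p i| = 2%N.
Hypothesis disj_p : forall i j, i != j -> [disjoint p i & p j].

(** The pairs stay arbitrary because two choices occur: i with its mirror image for [plucker_mx],
    and consecutive indices for the contraction. *)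
Definition pairing_mx : 'M[F]_(#|subsets 4 12|%N, #|subsets 6 12|%N) :=
  \matrix_(a, b) [exists i, enum_val b == enum_val a :|: p i]%:R.

Lemma card_enum_val_subsets l m (a : 'I_#|subsets l m|) : #|enum_val a| = l.
Proof. by have := enum_valP a; rewrite inE => /eqP. Qed.

(** An entry records only that some [i] exists, but this [i] is unique: [p i] is the part of the
    6-set missing from the 4-set. So the entry can be replaced by a sum over [i]. *)
Lemma sum_pairing_mx (u : {set 'I_12} -> F) b :
  \sum_a u (enum_val a) * pairing_mx a b =
    \sum_(i in full p (enum_val b)) u (enum_val b :\: p i).
Proof.
under eq_bigr do rewrite mxE.
set B := enum_val b; have cB : #|B| = 6%N by apply: card_enum_val_subsets.
rewrite -(big_enum_val (fun A => u A * [exists i, B == A :|: p i]%:R)) /=.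
have BDp (A : {set 'I_12}) i : #|A| = 4%N ->
    (B == A :|: p i) = (p i \subset B) && (A == B :\: p i).
  by move=> cA; apply: (eq_setU_pair card_p); rewrite cB cA.
transitivity (\sum_(A in subsets 4 12)
    \sum_(i in full p B) (if A == B :\: p i then u A else 0)).
  apply: eq_bigr => A; rewrite inE => /eqP cA.
  have [/existsP[i BAi] | nex] := boolP [exists i, B == A :|: p i]; last first.
    rewrite mulr0 big1 // => i; rewrite inE => iB.
    by case: ifP => // AB; case/existsP: nex; exists i; rewrite BDp // iB.
  move: (BAi); rewrite BDp // => /andP[piB /eqP defA].
  rewrite mulr1 (bigD1 i) ?inE //= -defA eqxx big1 ?addr0 // => j /andP[].
  rewrite inE => pjB ji; case: eqP => // defA'.
  have /card_gt0P[x xj] : (0 < #|p j|)%N by rewrite card_p.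
  have : x \in A by rewrite defA inE (disjointFr (disj_p ji)) ?(subsetP pjB).
  by rewrite defA' inE xj.
rewrite exchange_big; apply: eq_bigr => i; rewrite inE => iB.
rewrite -big_mkcondr (big_pred1 (B :\: p i)) // => A; rewrite /= andbC.
case: eqP => // ->; rewrite inE cardsD (setIidPr iB) cB card_p.
by [].
Qed.

Lemma rank_pairing_mx : (\rank pairing_mx = 494)%N.
Proof.
pose v : 'rV[F]_#|subsets 4 12| := \row_a (#|full p (enum_val a)| == 2%N)%:R.
have vker : v *m pairing_mx = 0.
  apply/rowP => b; rewrite !mxE.
  under eq_bigr do rewrite [v _ _]mxE.
  rewrite (sum_pairing_mx (fun A => (#|full p A| == 2%N)%:R)).
  by apply: indicator_ker => //; apply: card_enum_val_subsets.
have ker_v (w : 'rV_#|subsets 4 12|) : w *m pairing_mx = 0 ->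
  exists c, w = c *: v.
  (* The row vector becomes a function on all subsets, with value 0 off the 4-sets, so that
     [ker_indicator] applies. *)
  move=> /rowP wker; pose u A := \sum_a (if enum_val a == A then w 0 a else 0).
  have uE a : u (enum_val a) = w 0 a.
    by rewrite /u -big_mkcond (big_pred1 a) // => a';
      rewrite /= (inj_eq enum_val_inj).
  have [|c uc] := @ker_indicator _ _ p card_p disj_p F u char3 (card_ord 6).
    move=> B cB; have Bin : B \in subsets 6 12 by rewrite inE cB.
    have := wker (enum_rank_in Bin B); rewrite !mxE.
    under eq_bigr do rewrite -uE.
    by rewrite sum_pairing_mx enum_rankK_in.
  by exists c; apply/rowP => a; rewrite !mxE -uE uc // card_enum_val_subsets.
have v_neq0 : v != 0.
  (* Any two distinct indices would do: [v] has entry 1 at a union of two pairs. *)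
  pose A := pairs p [set ord0; ord_max].
  have cA : #|A| = 4%N by rewrite card_pairs // cards2.
  have Ain : A \in subsets 4 12 by rewrite inE cA.
  apply/eqP => /rowP/(_ (enum_rank_in Ain A)); rewrite !mxE enum_rankK_in //.
  have := full_pairs card_p disj_p (A := set0) [set ord0; ord_max].
  rewrite set0U => ->; first by rewrite cards2 => /eqP; rewrite oner_eq0.
  by apply/setP => i; rewrite !inE subset0 -cards_eq0 card_p.
have rkv : \rank v = 1%N by rewrite rank_rV v_neq0.
have rk1 : \rank (kermx pairing_mx) = 1%N.
  apply: etrans rkv; apply/eqP; rewrite eqn_leq; apply/andP; split;
    apply/mxrankS; last exact/sub_kermxP.
  apply/row_subP => i.
  have [|c ->] := ker_v (row i (kermx pairing_mx)); last exact: scalemx_sub.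
  by apply/sub_kermxP; apply: row_sub.
have := rank_leq_row pairing_mx.
have c4 : #|subsets 4 12| = 495%N by rewrite /subsets card_draws card_ord.
by move: rk1; rewrite mxrank_ker; lia.
Qed.

End PairingMatrix.

Lemma rank_plucker_mx (F : fieldType) : 3%N \in [pchar F] ->
  (\rank (plucker_mx F) = 494)%N.
Proof.
move=> char3; pose lo (i : 'I_6) : 'I_12 := widen_ord (isT : 6 <= 12)%N i.
pose p i := [set lo i; rev_ord (lo i)].
have -> : plucker_mx F = pairing_mx F p.
  apply/matrixP => a b; rewrite !mxE; congr (_ (nat_of_bool _)).
  apply/existsP/existsP => [[i /andP[lti /eqP->]] | [i /eqP->]].
    by exists (Ordinal lti); rewrite /p (_ : lo _ = i) //; apply: val_inj.
  by exists (lo i); rewrite /= ltn_ord eqxx.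
apply: rank_pairing_mx => // [i | i j].
  by rewrite cards2 -val_eqE /=; have := ltn_ord i; lia.
move=> /eqP ij; apply/pred0P => x; rewrite /= !inE -!val_eqE /=.
have := ltn_ord i; have := ltn_ord j; have : i <> j :> nat by move/val_inj.
lia.
Qed.

(** * Bases of exterior powers *)

Section IncreasingMaps.
Variables (k n : nat).
Implicit Types (f g : 'I_k -> 'I_n) (A : {set 'I_n}).

Definition increasing f := forall i j : 'I_k, (i < j)%N -> (f i < f j)%N.

(** The lists of values are strictly sorted and of the same length, so inclusion of one in the other
    makes them equal. *)
Lemma increasing_eq f g : increasing f -> increasing g ->
  (forall i, exists j, f i = g j) -> f =1 g.
Proof.
pose s (h : 'I_k -> 'I_n) := [seq val (h i) | i <- enum 'I_k].
have sorted_s h : increasing h -> sorted ltn (s h).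
  move=> incr_h; rewrite sorted_map.
  have : sorted (relpre val ltn) (enum 'I_k).
    by rewrite -sorted_map val_enum_ord iota_ltn_sorted.
  by apply: sub_sorted => i j; apply: incr_h.
move=> incr_f incr_g fg.
have [_ eq_mem] : (size (s f) = size (s g)) * (s f =i s g).
  apply: uniq_min_size; last by rewrite !size_map.
    exact: (sorted_uniq ltn_trans ltnn (sorted_s _ incr_f)).
  move=> _ /mapP[i _ ->]; have [j ->] := fg i.
  by apply/mapP; exists j; rewrite ?mem_enum.
have := irr_sorted_eq ltn_trans ltnn (sorted_s _ incr_f) (sorted_s _ incr_g)
  eq_mem.
by move=> /eq_in_map eq_fg i; apply/val_inj/eq_fg; rewrite mem_enum.
Qed.

(** The increasing enumeration of [A], indexed by ['I_k] and not by ['I_#|A|], so that all k-subsets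
    give families of the same type. *)
Definition elt (A : {set 'I_n}) (cA : #|A| = k) (j : 'I_k) : 'I_n :=
  enum_val (cast_ord (esym cA) j).

Lemma elt_in A (cA : #|A| = k) j : elt cA j \in A.
Proof. exact: enum_valP. Qed.

Lemma elt_surj A (cA : #|A| = k) x : x \in A -> exists j, x = elt cA j.
Proof.
by move=> xA; exists (cast_ord cA (enum_rank_in xA x));
  rewrite /elt cast_ordK enum_rankK_in.
Qed.

Lemma elt_increasing A (cA : #|A| = k) : increasing (elt cA).
Proof.
move=> i j ij; pose x0 := elt cA i.
have val_elt l : val (elt cA l) = nth 0%N (map val (enum A)) l.
  by rewrite (nth_map x0) -?cardE ?cA //; congr val; apply: enum_val_nth.
have srt : sorted ltn (map val (enum A)).
  rewrite sorted_map; apply: sorted_filter => [? ? ?|]; first exact: ltn_trans.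
  by rewrite -enumT -sorted_map val_enum_ord iota_ltn_sorted.
rewrite !val_elt; apply: (sorted_ltn_nth ltn_trans 0%N srt) => //.
all: by rewrite inE size_map -cardE cA.
Qed.

Lemma increasing_inj f : increasing f -> injective f.
Proof.
move=> incr_f i j eq_f; apply: val_inj.
by case: (ltngtP i j) => // /incr_f; rewrite eq_f ltnn.
Qed.

End IncreasingMaps.

(** * Alternating maps are determined on increasing families of basis vectors *)

Section AlternatingMaps.
Variables (F : fieldType) (E V : vectType F) (k : nat).
Variable g : {ffun 'I_k -> E} -> V.
Implicit Types x : {ffun 'I_k -> E}.
Hypotheses (g_ml : multilinear g) (g_alt : alternating g).

Lemma ffun_updE (x : {ffun 'I_k -> E}) i u j :
  ffun_upd x i u j = if j == i then u else x j.
Proof. by rewrite ffunE. Qed.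

Lemma ffun_upd_id (x : {ffun 'I_k -> E}) i : ffun_upd x i (x i) = x.
Proof. by apply/ffunP => j; rewrite ffunE; case: eqP => [->|]. Qed.

Lemma multilinear0 x i : g (ffun_upd x i 0) = 0.
Proof.
have := g_ml x i (-1) 0 0.
by rewrite scaler0 addr0 scaleN1r addNr.
Qed.

Lemma multilinearD x i u v :
  g (ffun_upd x i (u + v)) = g (ffun_upd x i u) + g (ffun_upd x i v).
Proof. by have := g_ml x i 1 u v; rewrite !scale1r. Qed.

(** Expand the value, which is 0, of [g] at the family with [x i + x j] in both places. *)
Lemma alternating_tperm x i j : i != j ->
  g [ffun l => x (tperm i j l)] = - g x.
Proof.
move=> ij; pose y u v := ffun_upd (ffun_upd x i u) j v.
have ji : j != i by rewrite eq_sym.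
have yC u v : y u v = ffun_upd (ffun_upd x j v) i u.
  by apply/ffunP => l; rewrite !ffunE; case: (eqVneq l i) => // ->;
    rewrite (negPf ij).
have alt u : g (y u u) = 0.
  by apply: (g_alt ij); rewrite !ffunE eqxx eqxx (negPf ij).
have addl u u' v : g (y (u + u') v) = g (y u v) + g (y u' v).
  by rewrite !yC multilinearD.
have addr u v v' : g (y u (v + v')) = g (y u v) + g (y u v').
  exact: multilinearD.
have yx : y (x i) (x j) = x.
  by rewrite yC !ffun_upd_id.
have := alt (x i + x j); rewrite addr !addl !alt yx add0r addr0.
move/eqP; rewrite addr_eq0 => /eqP <-.
congr g; apply/ffunP => l; rewrite !ffunE.
case: tpermP => [->|->|/eqP/negPf-> /eqP/negPf-> //]; rewrite ?eqxx //.
by rewrite (negPf ij).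
Qed.

(** Only vanishing is transported, so a decomposition into transpositions suffices and the signature
    is never computed. *)
Lemma alternating_perm_eq0 x (s : {perm 'I_k}) : g x = 0 ->
  g [ffun l => x (s l)] = 0.
Proof.
move=> gx0; have [ts -> dts] := prod_tpermP s.
elim: ts dts => [|t ts IH] /= => [_|/andP[dt /IH gts]].
  by rewrite big_nil -[RHS]gx0; congr g; apply/ffunP => l; rewrite ffunE perm1.
have := alternating_tperm [ffun l => x ((\prod_(t <- ts) tperm t.1 t.2)%g l)]
  dt.
rewrite gts oppr0 => <-; congr g; apply/ffunP => l.
by rewrite !ffunE big_cons permM.
Qed.

Variables (n : nat) (X : n.-tuple E).
Hypothesis X_basis : basis_of fullv X.

Lemma multilinear_eq0_basis :
  (forall phi : 'I_k -> 'I_n, g [ffun j => X`_(phi j)] = 0) ->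
    forall x, g x = 0.
Proof.
(* Induction on m: the entries before position m are arbitrary, the others are basis vectors. *)
move=> gX; suff IH m : forall x : {ffun 'I_k -> E},
    (forall j : 'I_k, (m <= j)%N -> exists l : 'I_n, x j = X`_l) -> g x = 0.
  by move=> x; apply: (IH k) => j; rewrite leqNgt ltn_ord.
elim: m => [|m IH] x xX.
  have [phi xphi] : exists phi : 'I_k -> 'I_n, forall j, x j = X`_(phi j).
    by apply: (@fin_all_exists _ (fun=> 'I_n) (fun j l => x j = X`_l)) => j;
      apply: xX.
  by rewrite -(gX phi); congr g; apply/ffunP => j; rewrite ffunE.
have [km | mk] := leqP k m.
  by apply: IH => j mj; have := ltn_ord j; rewrite ltnNge (leq_trans km mj).
rewrite -(ffun_upd_id x (Ordinal mk)) (coord_basis X_basis (memvf (x _))).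
elim/big_rec: _ => [|l u _ gu]; first exact: multilinear0.
rewrite g_ml gu addr0 (IH (ffun_upd x _ _)) ?scaler0 // => j mj.
rewrite ffun_updE; case: eqP => [_|jm]; first by exists l.
apply: xX; rewrite ltn_neqAle mj andbT; apply/eqP => mj'.
by apply: jm; apply: val_inj.
Qed.

(** A family of basis vectors either repeats an index, and [g] vanishes, or is a permutation of an
    increasing family. *)
Lemma alternating_eq0_basis :
  (forall (A : {set 'I_n}) (cA : #|A| = k), g [ffun j => X`_(elt cA j)] = 0) ->
  forall x, g x = 0.
Proof.
move=> gX; apply: multilinear_eq0_basis => phi.
have [/injectiveP phi_inj | /injectivePn[i [j ij eq_phi]]] :=
  boolP (injectiveb phi); last first.
  by apply: (g_alt ij); rewrite !ffunE eq_phi.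
pose A := [set phi j | j in 'I_k].
have cA : #|A| = k by rewrite card_imset // card_ord.
have [s phi_s] : exists s : 'I_k -> 'I_k, forall j, phi j = elt cA (s j).
  apply: (@fin_all_exists _ (fun=> 'I_k) (fun j l => phi j = elt cA l)) => j.
  by apply: elt_surj; apply: imset_f.
have s_inj : injective s by move=> i j eq_s; apply: phi_inj;
  rewrite !phi_s eq_s.
have := alternating_perm_eq0 (perm s_inj) (gX A cA) => <-.
by congr g; apply/ffunP => j; rewrite !ffunE permE phi_s.
Qed.
End AlternatingMaps.

(** * The basis of an exterior power given by a basis of the space *)

Section ExteriorBasis.
Variables (F : fieldType) (E : vectType F) (n : nat) (X : n.-tuple E).
Hypothesis X_basis : basis_of fullv X.
Variables (k : nat) (W : extPower E k).
Implicit Types A B : {set 'I_n}.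

Definition sub_family (A : {set 'I_n}) (cA : #|A| = k) : {ffun 'I_k -> E} :=
  [ffun j => X`_(elt cA j)].

(** Through the universal property, this minor of the coordinate matrix gives the linear form dual
    to the wedge indexed by [A]. The type [F^o] is [F] seen as a vector space, as the universal
    property requires. *)
Definition minor (A : {set 'I_n}) (cA : #|A| = k) (x : {ffun 'I_k -> E}) :
  F^o :=
  \det (\matrix_(i < k, j < k) coord X (elt cA j) (x i)).

Lemma minor_multilinear A (cA : #|A| = k) : multilinear (minor cA).
Proof.
move=> x i a u v; rewrite /minor -[X in _ = _ + X]mul1r.
apply: (determinant_multilinear (i0 := i)).
- by apply/rowP => j; rewrite !mxE !ffunE eqxx linearP mul1r.
- by apply/matrixP => l j; rewrite !mxE !ffunE eq_sym (negPf (neq_lift i l)).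
- by apply/matrixP => l j; rewrite !mxE !ffunE eq_sym (negPf (neq_lift i l)).
Qed.

Lemma minor_alternating A (cA : #|A| = k) : alternating (minor cA).
Proof.
move=> x i j ij eq_x; apply: (determinant_alternate ij) => l.
by rewrite !mxE eq_x.
Qed.

Lemma minor_sub_family (A B : {set 'I_n}) (cA : #|A| = k) (cB : #|B| = k) :
  minor cA (sub_family cB) = (A == B)%:R.
Proof.
have X_free := basis_free X_basis.
have [eqAB | neqAB] := eqVneq A B.
  subst B; rewrite (eq_irrelevance cB cA) /minor -[RHS](det1 F k).
  congr (\det _); apply/matrixP => i j; rewrite !mxE ffunE coord_free //.
  by rewrite (inj_eq (increasing_inj (elt_increasing cA))) eq_sym.
(* Sets of equal size that differ are not included in one another; an element of [B] outside [A]
   gives a zero row. *)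
have [x xB xA] : exists2 x, x \in B & x \notin A.
  by apply/subsetPn; apply: contraNN neqAB => BA;
    rewrite eq_sym eqEcard BA cA cB /=.
have [i def_x] := elt_surj cB xB.
rewrite /minor (expand_det_row _ i) big1 // => j _.
rewrite !mxE ffunE coord_free // -def_x (_ : (_ == _) = false) ?mul0r //.
by apply: contraNF xA => /eqP ->; apply: elt_in.
Qed.

(** The uniqueness half of the universal property: [h] and 0 both extend the zero map. *)
Lemma wedge_eq0_basis (V : vectType F) (h : 'Hom(W, V)) :
  (forall (A : {set 'I_n}) (cA : #|A| = k), h (wedge W (sub_family cA)) = 0) ->
    h = 0.
Proof.
move=> hX; have hw : forall x, h (wedge W x) = 0.
  apply: (alternating_eq0_basis (g := h \o wedge W) _ _ X_basis) => //.
    by move=> x i a u v; rewrite /= wedge_multilinear linearP.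
  by move=> x i j ij eq_x; rewrite /= (wedge_alternating W ij eq_x) linear0.
have [||h0 [_ h0_uniq]] := @wedge_universal _ _ _ W V (fun=> 0).
- by move=> x i a u v; rewrite scaler0 addr0.
- by [].
- by rewrite -(h0_uniq h hw); apply: h0_uniq => x; rewrite lfunE.
Qed.

Definition ext_basis : #|subsets k n|.-tuple W :=
  [tuple wedge W (sub_family (card_enum_val_subsets a)) | a < #|subsets k n|].

Lemma ext_basisE (a : 'I_#|subsets k n|) :
  ext_basis`_a = wedge W (sub_family (card_enum_val_subsets a)).
Proof. by rewrite -tnth_nth tnth_mktuple. Qed.

Lemma mem_ext_basis (A : {set 'I_n}) (cA : #|A| = k) :
  exists2 a : 'I_#|subsets k n|, enum_val a = A &
    wedge W (sub_family cA) = ext_basis`_a.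
Proof.
have Ain : A \in subsets k n by rewrite inE cA.
have defA := enum_rankK_in Ain Ain.
exists (enum_rank_in Ain A) => //; rewrite ext_basisE.
move: (card_enum_val_subsets _); rewrite defA => cA';
  by rewrite (eq_irrelevance cA' cA).
Qed.

Lemma ext_basisP : basis_of fullv ext_basis.
Proof.
rewrite /basis_of andbC eqEsubv subvf; apply/andP; split.
  (* Freeness: apply the linear form induced by the minor of index [a]. *)
  apply/freeP => c sum0 a.
  have [h [hE _]] :=
    @wedge_universal _ _ _ W F^o (minor (card_enum_val_subsets a))
    (minor_multilinear _) (@minor_alternating _ _).
  have := congr1 h sum0; rewrite linear0 linear_sum (bigD1 a) //= big1 ?addr0.
    rewrite linearZ /= ext_basisE hE minor_sub_family eqxx => <-.
    by rewrite /GRing.scale /= mulr1.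
  move=> b ba; rewrite linearZ /= ext_basisE hE minor_sub_family.
  by rewrite (inj_eq enum_val_inj) eq_sym (negPf ba) scaler0.
(* Spanning: the identity minus a projection onto the span kills every wedge of basis vectors, hence
   is 0. *)
suff proj0 : \1%VF - projv <<ext_basis>>%VS = 0.
  apply/subvP => w _; have := congr1 (fun h : 'Hom(W, W) => h w) proj0.
  rewrite add_lfunE opp_lfunE id_lfunE zero_lfunE => /eqP;
    rewrite subr_eq0 => /eqP ->.
  exact: memv_proj.
apply: wedge_eq0_basis => A cA; have [a _ ->] := mem_ext_basis cA.
rewrite add_lfunE opp_lfunE id_lfunE projv_id ?subrr // memv_span // mem_nth //.
by rewrite size_tuple.
Qed.
End ExteriorBasis.

(** * Symplectic bases *)

Section SymplecticBasis.
Variables (F : fieldType) (E : vectType F) (form : {biscalar E}).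
Hypothesis form_sympl : symplectic form.

Lemma form_alt x : form x x = 0.
Proof. by case: form_sympl. Qed.

Lemma form_skew x y : form x y = - form y x.
Proof.
apply/eqP; rewrite -addr_eq0; apply/eqP.
have := form_alt (x + y); rewrite linearDl !linearDr /= !form_alt.
by rewrite add0r addr0 addrC.
Qed.

(** Each vector of [s] imposes one linear condition, which lowers the dimension by at most one; the
    induction carries the subspace of solutions. *)
Lemma exists_orthogonal (s : seq E) : (size s < \dim {:E})%N ->
  exists2 x, x != 0 & {in s, forall v, form v x = 0}.
Proof.
suff [U sU U_orth] : exists2 U : {vspace E}, (\dim {:E} <= \dim U + size s)%N &
    {in s, forall v, {in U, forall x, form v x = 0}}.
  move=> lt_s; exists (vpick U).
    by rewrite vpick0 -dimv_eq0; lia.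
  by move=> v vs; apply: U_orth => //; apply: memv_pick.
elim: s => [|v s [U sU U_orth]]; first by exists fullv; rewrite ?addn0.
exists (U :&: lker (linfun (form v : E -> F^o)))%VS.
  have := limg_ker_dim (linfun (form v : E -> F^o)) U.
  have := dimvS (subvf (linfun (form v : E -> F^o) @: U)%VS).
  by rewrite dimvf /dim /=; lia.
move=> w; rewrite inE => /orP[/eqP -> | ws] x;
  rewrite memv_cap memv_ker => /andP[xU].
  by rewrite lfunE => /eqP.
by move=> _; apply: U_orth.
Qed.
(** Sequences over [nat], of which only the first [m] terms count: a further pair is appended
    without changing the type. *)
Definition hyperbolic m (a b : nat -> E) :=
  forall i j, (i < m)%N -> (j < m)%N ->
  [/\ form (a i) (a j) = 0, form (b i) (b j) = 0
    & form (a i) (b j) = (i == j)%:R].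

Lemma hyperbolic_extend m a b : (2 * m < \dim {:E})%N -> hyperbolic m a b ->
  exists a' b', hyperbolic m.+1 a' b'.
Proof.
move=> lt_m hyp.
have [|x x_neq0 x_orth] := @exists_orthogonal (mkseq a m ++ mkseq b m).
  by rewrite size_cat !size_mkseq; lia.
have ax i : (i < m)%N -> form (a i) x = 0.
  by move=> im; apply: x_orth; rewrite mem_cat map_f // mem_iota.
have bx i : (i < m)%N -> form (b i) x = 0.
  by move=> im; apply: x_orth; rewrite mem_cat orbC map_f // mem_iota.
have [y0 xy0] : exists y0, form x y0 = 1.
  have [z xz] : exists z, form x z != 0.
    have [_ nondeg] := form_sympl.
    have [/lfunPn[z] | ] := boolP (linfun (form x : E -> F^o) != 0).
      by rewrite lfunE zero_lfunE; exists z.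
    rewrite negbK => /eqP/lfunP form0; case/eqP: x_neq0; apply: nondeg => y.
    by have := form0 y; rewrite lfunE zero_lfunE.
  exists ((form x z)^-1 *: z).
  by rewrite linearZr_LR /= mulVf.
(* Subtract from [y0] its component in the span of the pairs found so far. As [x] is orthogonal to
   that span, its pairing with [y0] is unchanged. *)
pose y := y0 - \sum_(i < m) (form (a i) y0 *: b i - form (b i) y0 *: a i).
have form_y v : form v y = form v y0 -
    \sum_(i < m) (form (a i) y0 * form v (b i) - form (b i) y0 * form v (a i)).
  rewrite linearBr linear_sumr; congr (_ - _); apply: eq_bigr => i _.
  by rewrite linearBr !linearZr_LR.
have ay i : (i < m)%N -> form (a i) y = 0.
  move=> im; rewrite form_y (bigD1 (Ordinal im)) //= big1 => [|j ji].
    have [-> _ ->] := hyp _ _ im im; rewrite eqxx /=; ring.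
  have [-> _ ->] := hyp i j im (ltn_ord j);
  rewrite (_ : i == j :> nat = false) /=; first by ring.
  by apply: contraNF ji => /eqP ij; apply/eqP/val_inj.
have by_ i : (i < m)%N -> form (b i) y = 0.
  move=> im; rewrite form_y (bigD1 (Ordinal im)) //= big1 => [|j ji].
    have [_ -> ab] := hyp _ _ im im;
      rewrite [form (b i) (a i)]form_skew ab eqxx /=; ring.
  have [_ -> _] := hyp i j im (ltn_ord j);
  have [_ _ ab] := hyp j i (ltn_ord j) im.
  rewrite [form (b i) (a j)]form_skew ab (_ : j == i :> nat = false) /=;
    first by ring.
  by apply: contraNF ji => /eqP ij; apply/eqP/val_inj.
have xy : form x y = 1.
  rewrite form_y big1 ?subr0 // => j _.
  by rewrite ![form x _]form_skew ax // bx // oppr0 !mulr0 subr0.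
exists (fun i => if (i < m)%N then a i else x),
  (fun i => if (i < m)%N then b i else y).
move=> i j; rewrite !ltnS => im jm.
have [im'|/(conj im)/andP/anti_leq->] := ltnP i m;
  have [jm'|/(conj jm)/andP/anti_leq->] := ltnP j m.
- exact: hyp.
- rewrite ax // by_ // ay //; split=> //.
  by rewrite ltn_eqF.
- split; rewrite form_skew ?ax ?by_ ?bx ?oppr0 //.
  by rewrite gtn_eqF.
- by rewrite !form_alt eqxx.
Qed.

Lemma exists_hyperbolic m : (2 * m <= \dim {:E})%N ->
  exists a b, hyperbolic m a b.
Proof.
elim: m => [|m IH] dim_m; first by exists (fun=> 0), (fun=> 0).
have [|a [b hyp]] := IH; first by lia.
by apply: hyperbolic_extend hyp; lia.
Qed.

End SymplecticBasis.

(** * The contraction in a symplectic basis *)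

Section LinearImage.
Variables (F : fieldType) (U V : vectType F) (m n : nat).
Variables (e : m.-tuple U) (e' : n.-tuple V) (f : 'Hom(U, V))
  (M : 'M[F]_(m, n)).

Lemma sum_mulmx k (c : 'rV[F]_k) (N : 'M_(k, n)) :
  \sum_i c 0 i *: (\sum_j N i j *: e'`_j) = \sum_j (c *m N) 0 j *: e'`_j.
Proof.
under eq_bigr do rewrite scaler_sumr.
rewrite exchange_big; apply: eq_bigr => j _; rewrite mxE scaler_suml.
by apply: eq_bigr => i _; rewrite scalerA.
Qed.

(** Row [i] of [M] holds the coordinates of the image of the i-th basis vector, so the image
    corresponds to the row space. A basis [row_base M] of the latter yields the basis [Y] of the
    image. *)
Lemma dim_limg_mx : basis_of fullv e -> basis_of fullv e' ->
  (forall i : 'I_m, f e`_i = \sum_j M i j *: e'`_j) -> \dim (limg f) = \rank M.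
Proof.
move=> e_basis e'_basis fE.
pose Y := [tuple \sum_j row_base M i j *: e'`_j | i < \rank M].
have YE (i : 'I_(\rank M)) : Y`_i = \sum_j row_base M i j *: e'`_j.
  by rewrite -tnth_nth tnth_mktuple.
have sumY (c : 'rV_(\rank M)) :
    \sum_i c 0 i *: Y`_i = \sum_j (c *m row_base M) 0 j *: e'`_j.
  by rewrite -sum_mulmx; apply: eq_bigr => i _; rewrite YE.
have f_sum (c : 'rV_m) :
    f (\sum_i c 0 i *: e`_i) = \sum_j (c *m M) 0 j *: e'`_j.
  by rewrite linear_sum -sum_mulmx; apply: eq_bigr => i _;
    rewrite linearZ /= fE.
have coordE k (Z : k.-tuple V) v : v \in <<Z>>%VS ->
  v = \sum_i (\row_i coord Z i v) 0 i *: Z`_i.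
  by move=> vZ; rewrite [LHS](coord_span vZ); apply: eq_bigr => i _;
    rewrite mxE.
have Y_free : free Y.
  apply/freeP => c sum0 i; have := sumY (\row_i c i).
  under eq_bigr do rewrite mxE.
  have /freeP e_free := basis_free e'_basis.
  rewrite sum0 => /esym/(e_free (fun j => (\row_i c i *m row_base M) 0 j)) cM0.
  have /(row_free_inj (row_base_free M)) /rowP/(_ i) :
    (\row_i c i) *m row_base M = 0 *m row_base M.
    by rewrite mul0mx; apply/rowP => j; rewrite cM0 mxE.
  by rewrite !mxE.
have defY : <<Y>>%VS = limg f.
  apply/vspaceP => v; apply/idP/memv_imgP => [vY | [u _ ->]].
    rewrite (coordE _ _ _ vY) sumY.
    have /submxP[w ->] : ((\row_i coord Y i v) *m row_base M <= M)%MS.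
      by rewrite (submx_trans (submxMl _ _)) // eq_row_base.
    by exists (\sum_i w 0 i *: e`_i); rewrite ?memvf.
  have -> : u = \sum_i (\row_i coord e i u) 0 i *: e`_i.
    by rewrite [LHS](coord_basis e_basis (memvf u)); apply: eq_bigr => i _;
      rewrite mxE.
  rewrite f_sum.
  have /submxP[c ->] : ((\row_i coord e i u) *m M <= row_base M)%MS.
    by rewrite eq_row_base submxMl.
  by rewrite -sumY; apply: memv_suml => i _;
    rewrite memvZ // memv_span // mem_nth // size_tuple.
by rewrite -defY (eqP Y_free) size_tuple.
Qed.
End LinearImage.

Section Contraction.
Variables (F : fieldType) (E : vectType F).

(** The enumeration of [B] that skips positions [s] and [t] is increasing with values in [C], hence
    it is the enumeration of [C] by [increasing_eq]. *)
Lemma omit2_sub_family n (X : n.-tuple E) k (B C : {set 'I_n})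
    (cB : #|B| = k.+2) (cC : #|C| = k) (s t : 'I_k.+2) : (s < t)%N ->
  C = B :\: [set elt cB s; elt cB t] ->
  omit2 s t (sub_family X cB) = sub_family X cC.
Proof.
move=> st defC; have incrB := elt_increasing cB.
(* [inord] keeps the value of [s], because s < t <= k + 1. *)
have val_s : val (inord s : 'I_k.+1) = s.
  by rewrite /= inordK //; have := ltn_ord t; lia.
pose r (j : 'I_k) := lift t (lift (inord s) j).
have rE j : val (r j) = bump t (bump s j) by rewrite /= -[in RHS]val_s.
suff eq_elt : (fun j => elt cB (r j)) =1 elt cC.
  by apply/ffunP => j; rewrite !ffunE -eq_elt.
apply: increasing_eq => [i j ij| |i]; last first.
- apply: elt_surj;
  rewrite defC !inE elt_in andbT !(inj_eq (increasing_inj incrB)).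
  rewrite -!val_eqE !rE /bump /=; lia.
- exact: elt_increasing.
- by apply: incrB; rewrite !rE /bump; lia.
Qed.
Variable form : {biscalar E}.
Hypothesis form_sympl : symplectic form.
Variables (a b : nat -> E).
Hypothesis ab_hyp : hyperbolic form 6 a b.
Hypothesis dim_E : \dim {:E} = 12%N.

(** The order is a_0, b_0, ..., a_5, b_5, which makes hyperbolic partners adjacent. *)
Definition sympl_tuple : 12.-tuple E :=
  [tuple (if odd l then b l./2 else a l./2) | l < 12].

Lemma sympl_tupleE (l : 'I_12) :
  sympl_tuple`_l = if odd l then b l./2 else a l./2.
Proof. by rewrite -tnth_nth tnth_mktuple. Qed.

Lemma form_sympl_tuple (s t : 'I_12) : (s < t)%N ->
  form sympl_tuple`_s sympl_tuple`_t = (~~ odd s && (t == s.+1 :> nat))%:R.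
Proof.
move=> st; rewrite !sympl_tupleE.
have s6 : (s./2 < 6)%N by have := ltn_ord s; lia.
have t6 : (t./2 < 6)%N by have := ltn_ord t; lia.
have [aa bb ab] := ab_hyp s6 t6; have [_ _ ba] := ab_hyp t6 s6.
have [os|os] := boolP (odd s); have [ot|ot] := boolP (odd t);
  rewrite /= ?aa ?bb ?ab //.
- rewrite (form_skew form_sympl) ba (_ : (_ == _) = false) ?oppr0 //.
  by apply/eqP; lia.
- by congr (_ (nat_of_bool _)); apply/eqP/eqP; lia.
- by rewrite (_ : (_ == _) = false) //; apply/eqP; lia.
Qed.

Lemma sympl_tuple_basis : basis_of fullv sympl_tuple.
Proof.
rewrite basisEfree subvf dim_E size_tuple leqnn !andbT.
apply/freeP => c sum0 l.
have form0 v : \sum_(i < 12) c i * form v sympl_tuple`_i = 0.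
  rewrite -[RHS](linear0r form v) -[in RHS]sum0 linear_sumr.
  by apply: eq_bigr => i _; rewrite linearZr_LR.
have lt_l := ltn_ord l.
have l6 : (l./2 < 6)%N by lia.
(* Pairing the relation with the hyperbolic partner of vector [l] isolates [c l] up to sign. *)
have := form0 (if odd l then a l./2 else b l./2).
rewrite (bigD1 l) //= big1 ?addr0 => [|i il].
  rewrite sympl_tupleE; have [_ _ ab] := ab_hyp l6 l6.
  case: (odd l); rewrite 1?(form_skew form_sympl (b _)) ab eqxx ?mulrN mulr1 //.
  by move/eqP; rewrite oppr_eq0 => /eqP.
rewrite sympl_tupleE; have lt_i := ltn_ord i.
have i6 : (i./2 < 6)%N by lia.
have [aa bb ab] := ab_hyp l6 i6; have [_ _ ba] := ab_hyp i6 l6.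
have neq_il : val i <> val l by move/val_inj/eqP; rewrite (negPf il).
case ol: (odd l); case oi: (odd i); rewrite ?aa ?bb ?ab ?mulr0 //; last first.
  rewrite (form_skew form_sympl) ba (_ : (_ == _) = false) ?oppr0 ?mulr0 //.
  by apply/eqP; move: neq_il => /=; lia.
by rewrite (_ : (_ == _) = false) ?mulr0 //; apply/eqP; move: neq_il => /=; lia.
Qed.

Lemma double_lt12 (i : 'I_6) : (i.*2 < 12)%N.
Proof. by have := ltn_ord i; lia. Qed.
Lemma doubleS_lt12 (i : 'I_6) : (i.*2.+1 < 12)%N.
Proof. by have := ltn_ord i; lia. Qed.
Definition even_ord i := Ordinal (double_lt12 i).
Definition odd_ord i := Ordinal (doubleS_lt12 i).
Definition adjacent_pair i := [set even_ord i; odd_ord i].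

Lemma card_adjacent_pair i : #|adjacent_pair i| = 2%N.
Proof. by rewrite cards2 -val_eqE /=; lia. Qed.

Lemma disj_adjacent_pair i j : i != j ->
  [disjoint adjacent_pair i & adjacent_pair j].
Proof.
move=> ij; apply/pred0P => x; rewrite /= !inE -!val_eqE /=.
have : val i <> val j by move/val_inj/eqP; rewrite (negPf ij).
by move=> /=; lia.
Qed.

Lemma coord_sub_family k (W : extPower E k) (c : 'I_#|subsets k 12|)
    (A : {set 'I_12}) (cA : #|A| = k) :
  coord (ext_basis sympl_tuple W) c (wedge W (sub_family sympl_tuple cA)) =
    (enum_val c == A)%:R.
Proof.
have [d dA ->] := mem_ext_basis sympl_tuple W cA.
rewrite -dA coord_free ?(inj_eq enum_val_inj) //.
  by rewrite eq_sym.
exact: basis_free (ext_basisP sympl_tuple_basis W).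
Qed.

Variables (W6 : extPower E 6) (W4 : extPower E 4) (f : 'Hom(W6, W4)).
Hypothesis f_contr : is_contraction form f.

(** The form is nonzero only on hyperbolic partners 2i and 2i + 1. These occupy consecutive
    positions in [B], so the sign exponent is 2s + 2 and the sign is +1. *)
Lemma contraction_term (B : {set 'I_12}) (cB : #|B| = 6%N) c (s t : 'I_6) :
  (s < t)%N ->
  (-1) ^+ (s + t).+1 *
    form (sub_family sympl_tuple cB s) (sub_family sympl_tuple cB t) *
    coord (ext_basis sympl_tuple W4) c
      (wedge W4 (omit2 s t (sub_family sympl_tuple cB))) =
  [exists i, [&& elt cB s == even_ord i, elt cB t == odd_ord i &
     enum_val c == B :\: adjacent_pair i]]%:R.
Proof.
move=> st; have incrB := elt_increasing cB; have lt_st := incrB _ _ st.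
rewrite !ffunE form_sympl_tuple //.
have [/andP[os /eqP def_t] | nadj] := boolP (~~ odd (elt cB s) && _);
  last first.
  rewrite mulr0 mul0r (_ : [exists i, _] = false) //.
  apply: contraNF nadj => /existsP[i /and3P[/eqP-> /eqP-> _]] /=.
  by rewrite eqxx odd_double.
have lt_i : ((elt cB s)./2 < 6)%N by have := ltn_ord (elt cB s); lia.
pose i := Ordinal lt_i.
have si : elt cB s = even_ord i by apply: val_inj => /=; lia.
have ti : elt cB t = odd_ord i by apply: val_inj => /=; lia.
(* An element of [B] at a position between [s] and [t] would lie strictly between 2i and 2i + 1. *)
have def_ts : t = s.+1 :> nat.
  apply/eqP; rewrite eqn_leq st andbT leqNgt; apply/negP => ts1.
  have s1 : (s.+1 < 6)%N by have := ltn_ord t; lia.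
  have := incrB s (Ordinal s1) (ltnSn _); have := incrB (Ordinal s1) t ts1.
  by lia.
have cC : #|B :\: adjacent_pair i| = 4%N.
  rewrite cardsD (setIidPr _) ?cB ?card_adjacent_pair //.
  by apply/subsetP => x; rewrite !inE -si -ti => /orP[]/eqP->; apply: elt_in.
rewrite (@omit2_sub_family _ _ _ _ _ cB cC) ?si ?ti // coord_sub_family.
rewrite mulr1 def_ts addnS -signr_odd /= negbK oddD addbb mul1r.
congr (_ (nat_of_bool _)); apply/idP/existsP => [defc | [j /and3P[/eqP ij _]]].
  by exists i; rewrite !eqxx.
suff -> : j = i by [].
by apply: val_inj; move/(congr1 val): ij; rewrite /= ; lia.
Qed.

(** The transpose appears because [f] goes from 6-sets to 4-sets, while [pairing_mx] has its rows
    indexed by 4-sets. *)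
Lemma contraction_basis (d : 'I_#|subsets 6 12|) :
  f (ext_basis sympl_tuple W6)`_d =
    \sum_c (pairing_mx F adjacent_pair)^T d c *: (ext_basis sympl_tuple W4)`_c.
Proof.
rewrite [LHS](coord_basis (ext_basisP sympl_tuple_basis W4) (memvf _)).
apply: eq_bigr => c _; congr (_ *: _);
  rewrite ext_basisE f_contr linear_sum !mxE.
have cB := card_enum_val_subsets d;
  rewrite (eq_irrelevance (card_enum_val_subsets d) cB).
set B := enum_val d in cB *.
pose P s t i := [&& elt cB s == even_ord i, elt cB t == odd_ord i &
  enum_val c == B :\: adjacent_pair i].
transitivity (\sum_(s < 6) \sum_(t < 6 | (s < t)%N) [exists i, P s t i]%:R : F).
  apply: eq_bigr => s _; rewrite linear_sum; apply: eq_bigr => t st.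
  by rewrite linearZ /= -(contraction_term cB c st).
have eqBU i := eq_setU_pair card_adjacent_pair (A := enum_val c) (B := B) i.
rewrite !card_enum_val_subsets in eqBU.
have [/existsP[i BAi] | nex] :=
  boolP [exists i, B == enum_val c :|: adjacent_pair i]; last first.
  rewrite big1 // => s _; rewrite big1 // => t st.
  rewrite (_ : [exists i, P s t i] = false) //.
  apply: contraNF nex => /existsP[i /and3P[/eqP si /eqP ti defc]].
  apply/existsP; exists i; rewrite eqBU // defc andbT.
  by apply/subsetP => x; rewrite !inE -si -ti => /orP[]/eqP->; apply: elt_in.
move: (BAi); rewrite eqBU // => /andP[/subsetP qB defc].
have [s si] := elt_surj cB (qB _ (set21 _ _)).
have [t ti] := elt_surj cB (qB _ (set22 _ _)).
have incrB := elt_increasing cB.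
have st : (s < t)%N.
  rewrite ltnNge; apply/negP; rewrite leq_eqVlt => /orP[/eqP/val_inj ts|/incrB].
    by move: ti; rewrite ts -si => /(congr1 val) /=; lia.
  by rewrite -si -ti /=; lia.
(* The 4-set determines the removed pair, and the pair its positions in [B]: only one term of the
   double sum survives. *)
have Puniq s' t' : [exists i, P s' t' i] -> s' = s /\ t' = t.
  case/existsP => j /and3P[/eqP sj /eqP tj /eqP defc'].
  suff eq_ij : j = i.
    by split; apply: (increasing_inj incrB); rewrite -?si -?ti ?sj ?tj eq_ij.
  apply/eqP/negPn/negP => /disj_adjacent_pair dis.
  have : even_ord j \in B :\: adjacent_pair i.
    by rewrite inE (disjointFr dis (set21 _ _)) -sj elt_in.
  by rewrite -(eqP defc) defc' !inE eqxx.
rewrite (bigD1 s) //= (bigD1 t) //= big1 => [|t' /andP[_ tt']].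
  rewrite addr0 big1 => [|s' ss'].
    rewrite addr0 (_ : [exists i, P s t i]) //; apply/existsP; exists i.
    by rewrite /P -si -ti !eqxx defc.
  rewrite big1 // => t' _; rewrite (_ : [exists i, _] = false) //.
  by apply: contraNF ss' => /Puniq[-> _].
rewrite (_ : [exists i, _] = false) //.
by apply: contraNF tt' => /Puniq[_ ->].
Qed.

Lemma dim_limg_contraction : 3%N \in [pchar F] -> \dim (limg f) = 494%N.
Proof.
move=> char3.
rewrite (dim_limg_mx (ext_basisP sympl_tuple_basis W6)
  (ext_basisP sympl_tuple_basis W4) contraction_basis).
rewrite mxrank_tr; apply: rank_pairing_mx => //.
  exact: card_adjacent_pair.
exact: disj_adjacent_pair.
Qed.
End Contraction.

Lemma dim_extPower (F : fieldType) (E : vectType F) n (X : n.-tuple E) k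
    (W : extPower E k) :
  basis_of fullv X -> \dim {:W} = 'C(n, k).
Proof.
move=> X_basis; have /andP[/eqP <- /eqP ->] := ext_basisP X_basis W.
by rewrite size_tuple /subsets card_draws card_ord.
Qed.

Theorem mainTheorem1 (F : fieldType) (E : vectType F) (form : {biscalar E})
    (W6 : extPower E 6) (W4 : extPower E 4) (f : 'Hom(W6, W4)) :
  3%N \in [pchar F] ->
  \dim {:E} = 12%N ->
  symplectic form ->
  is_contraction form f ->
  [/\ \rank (plucker_mx F) = 494%N,
      \dim (lker f) = ('C(12, 6) - 494)%N /\ ('C(12, 6) - 494 = 430)%N
    & ~ (forall v : W4, exists u : W6, f u = v)].
Proof.
move=> char3 dimE form_sympl f_contr.
have [|a [b hyp]] := exists_hyperbolic form_sympl (m := 6);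
  first by rewrite dimE.
have X_basis := sympl_tuple_basis form_sympl hyp dimE.
have dim_f := dim_limg_contraction form_sympl hyp dimE f_contr char3.
split; first exact: rank_plucker_mx.
  split; last by [].
  have := limg_ker_dim f fullv.
  by rewrite capfv dim_f (dim_extPower W6 X_basis) => <-; rewrite addnK.
(* Surjectivity would give 494 = 'C(12, 4) = 495. *)
move=> f_surj; have : limg f = fullv.
  by apply/vspaceP => v; rewrite memvf; have [u <-] := f_surj v;
    rewrite memv_img ?memvf.
by move/(congr1 (fun U => \dim U)); rewrite dim_f (dim_extPower W4 X_basis).
Qed.
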